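(* Let $P\colon\mathbb E\to\mathbb B$ be a loosely discrete opfibration with cleavage $(\sigma,\mu,\kappa)$ and counit $\epsilon$. The following assignments and comparison data amount to a double functor $R\colon\mathbb E\to\mathrm{Elt}(\mathrm{Tw}(P))$ that commutes with $P$ and the canonical projection $\mathrm{Elt}(\mathrm{Tw}(P))\to\mathbb B$: an object $a$ goes to $(Pa,a)$; an arrow $u\colon a\to b$ goes to $(Pu,u)$; a proarrow $t\colon a\nrightarrow b$ goes to $(Pt,\mathrm{tgt}\,\epsilon_t)$; a cell $\alpha$ goes to $P\alpha$; the loose composition comparison at $s\colon a\nrightarrow b$, $t\colon b\nrightarrow c$ is $P_{s,t}$ and the loose identity comparison at $a$ is $P_a$. This $R$ is an equivalence in the sense that both $R_0$ and $R_1$ are weak equivalences of categories (fully faithful and essentially surjective).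
   Context: Conventions. A double category $\mathbb D$ means a pseudo double category: a category $\mathbb D_0$ of objects and arrows (tight morphisms), a category $\mathbb D_1$ of proarrows (loose morphisms, written $m\colon x\nrightarrow y$) and cells, functors $\mathrm{src},\mathrm{tgt}\colon\mathbb D_1\to\mathbb D_0$, loose composition $\odot$ (in diagrammatic order) and loose identities $\mathrm{id}_x$, with coherent invertible associators and unitors. $\alpha\colon(f\mid m\to n\mid g)$ denotes a cell with left arrow $f=\mathrm{src}\,\alpha$, top proarrow $m$, bottom proarrow $n$, right arrow $g=\mathrm{tgt}\,\alpha$; $1_m$ is the identity cell of $m$ in $\mathbb D_1$. Double functors are pseudo, with comparisons $P_{s,t}\colon Ps\odot Pt\cong P(s\odot t)$ and $P_a\colon\mathrm{id}_{Pa}\cong P(\mathrm{id}_a)$. Opfibrations. A double functor $P\colon\mathbb E\to\mathbb B$ is a loosely discrete (double) opfibration if the functor $\langle\mathrm{src},P_1\rangle\colon\mathbb E_1\to\mathbb E_0\times_{\mathbb B_0}\mathbb B_1$ into the strict pullback of $P_0$ and $\mathrm{src}\colon\mathbb B_1\to\mathbb B_0$ is a weak equivalence (fully faithful and essentially surjective). Objects of the pullback are pairs $(a,m)$ with $m\colon Pa\nrightarrow y$; morphisms are pairs $(u,\theta)$ with $\mathrm{src}\,\theta=Pu$. Cleavages. A cleavage for such a $P$ consists of a functor $\sigma\colon\mathbb E_0\times_{\mathbb B_0}\mathbb B_1\to\mathbb E_1$ that is left adjoint right inverse to $\langle\mathrm{src},P_1\rangle$ (i.e. $\langle\mathrm{src},P_1\rangle\sigma=1$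 and $\sigma\dashv\langle\mathrm{src},P_1\rangle$ with identity unit; write $\epsilon_t\colon\sigma(a,Pt)\to t$ for the counit at $t\colon a\nrightarrow b$), together with natural isomorphisms as follows. Write $m_!(a)=\mathrm{tgt}\,\sigma(a,m)$, $\theta_!(u)=\mathrm{tgt}\,\sigma(u,\theta)$, $m_!(u)=\mathrm{tgt}\,\sigma(u,1_m)$. There are natural isomorphisms $\mu_{a,m,n}\colon n_!m_!(a)\to(m\odot n)_!(a)$ and $\kappa_a\colon a\to(\mathrm{id}_{Pa})_!(a)$ in $\mathbb E_0$, with components sent by $P$ to identities, making $\mathrm{tgt}\,\sigma$ a pseudo-algebra structure on $P_0\colon\mathbb E_0\to\mathbb B_0$ for the pseudo-monad on $\mathbf{Cat}/\mathbb B_0$ given by pulling back along $\mathrm{src}$ and composing with $\mathrm{tgt}$: that is, in applicative order, with $\mathfrak a,\rho,\lambda$ the associator and right/left unitors of $\mathbb B$, $(\mathfrak a_{m,n,p})_!(1_a)\circ\mu_{a,m\odot n,p}\circ p_!(\mu_{a,m,n})=\mu_{a,m,n\odot p}\circ\mu_{m_!(a),n,p}$, $(\rho_m)_!(1_a)\circ\mu_{a,m,\mathrm{id}}\circ\kappa_{m_!(a)}=1$ and $(\lambda_m)_!(1_a)\circ\mu_{a,\mathrm{id},m}\circ m_!(\kappa_a)=1$. Moreover one requires: (associativity) for proarrows $s\colon a\nrightarrow b$, $t\colon b\nrightarrow c$ of $\mathbb E$, $\mathrm{tgt}\,\epsilon_{s\odot t}\circ(P_{s,t})_!(1_a)\circ\mu_{a,Ps,Pt}=\mathrm{tgt}\,\epsilon_t\circ(Pt)_!(\mathrm{tgt}\,\epsilon_s)$;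 (unitality) $\mathrm{tgt}\,\epsilon_{\mathrm{id}_a}\circ(P_a)_!(1_a)\circ\kappa_a=1_a$. The double category $\mathrm{Elt}(\mathrm{Tw}(P))$ (the double category of elements of the twisted functor $\mathrm{Tw}(P)\colon\mathbb B\rightsquigarrow\mathbf{Prof}$ given by fibers of $P$, sets of arrows over $f$, and the transition functors $m_!$) is explicitly the following. Let $\mathbb E_x$ be the category of objects $a$ of $\mathbb E$ with $Pa=x$ and arrows $u$ with $Pu=1_x$. Objects: pairs $(x,a)$ with $a\in\mathbb E_x$. Arrows $(x,a)\to(z,c)$: pairs $(f,u)$ with $f\colon x\to z$ in $\mathbb B$ and $u\colon a\to c$ in $\mathbb E$ with $Pu=f$; composition and identities as in $\mathbb B_0$ and $\mathbb E_0$. Proarrows $(x,a)\nrightarrow(y,b)$: pairs $(m,\bar m)$ with $m\colon x\nrightarrow y$ in $\mathbb B$ and $\bar m\colon m_!(a)\to b$ an isomorphism of $\mathbb E_y$. Cells with left $(f,u)$, right $(g,v)$, top $(m,\bar m)$, bottom $(n,\bar n)$: cells $\alpha\colon(f\mid m\to n\mid g)$ of $\mathbb B$ with $\bar n\circ\alpha_!(u)=v\circ\bar m$; composition of cells is that of $\mathbb B$. Loose composite of $(m,\bar m)\colon(x,a)\nrightarrow(y,b)$ and $(n,\bar n)\colon(y,b)\nrightarrow(z,c)$: $(m\odot n,\ \bar n\circ n_!(\bar m)\circ\mu_{a,m,n}^{-1})$; loose identity on $(x,a)$: $(\mathrm{id}_x,\kappa_a^{-1})$. The projection to $\mathbb B$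 takes first components and is the identity on cells. *)

(* Defs.v *)
From Stdlib Require Import ProofIrrelevance.
Set Warnings "-notation-overridden".
From mathcomp Require Import all_boot.

Set Implicit Arguments.
Unset Strict Implicit.
Unset Printing Implicit Defensive.

Declare Scope dbl_scope.
Open Scope dbl_scope.

Reserved Notation "g ∘ f" (at level 40, left associativity).
Reserved Notation "β ∙ α" (at level 40, left associativity).
Reserved Notation "s ⊙ t" (at level 40, left associativity).
Reserved Notation "f ≡ g" (at level 70, no associativity).
Reserved Notation "α ≣ β" (at level 70, no associativity).

Record category := Category {
  ob :> Type;
  hom : ob -> ob -> Type;
  idc : forall x, hom x x;
  comp : forall x y z, hom y z -> hom x y -> hom x z;
  comp1f : forall x y (f : hom x y), comp (idc y) f = f;
  compf1 : forall x y (f : hom x y), comp f (idc x) = f;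
  compA : forall x y z w (h : hom z w) (g : hom y z) (f : hom x y),
    comp h (comp g f) = comp (comp h g) f }.

Arguments hom {c} _ _.
Arguments idc {c} x.
Notation "g ∘ f" := (comp g f) : dbl_scope.

(** [f ≡ g] is equality in the collection of all arrows of a category: the
    endpoints of [f] and [g] need only be equal, not convertible. *)
Record arrow (C : category) := Arr { adom : C; acod : C; aval : hom adom acod }.
Notation "f ≡ g" := (Arr f = Arr g) : dbl_scope.

Record iso (C : category) (x y : C) := Iso {
  isof :> hom x y;
  isoV : hom y x;
  isoVK : isoV ∘ isof = idc x;
  isoK : isof ∘ isoV = idc y }.
Arguments iso {C} x y.

Record functor (C D : category) := Functor {
  fob :> C -> D;
  fmap : forall x y, hom x y -> hom (fob x) (fob y);
  fmap1 : forall x, fmap (idc x) = idc (fob x);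
  fmapM : forall x y z (g : hom y z) (f : hom x y),
    fmap (g ∘ f) = fmap g ∘ fmap f }.
Arguments fmap {C D} F {x y} f : rename.

Definition functor_id (C : category) : functor C C :=
  @Functor C C id (fun _ _ => id) (fun=> erefl) (fun _ _ _ _ _ => erefl).

Definition functor_comp (C D E : category) (G : functor D E) (F : functor C D) :
  functor C E.
Proof.
refine (@Functor C E (fun x => G (F x)) (fun _ _ f => fmap G (fmap F f)) _ _).
- by move=> x; rewrite !fmap1.
- by move=> x y z g f; rewrite !fmapM.
Defined.

Definition functor_eq (C D : category) (F G : functor C D) : Prop :=
  (forall x, F x = G x) /\ (forall x y (f : hom x y), fmap F f ≡ fmap G f).

Definition fully_faithful (C D : category) (F : functor C D) : Prop :=
  forall x y, bijective (@fmap C D F x y).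

Definition ess_surjective (C D : category) (F : functor C D) : Prop :=
  forall y, exists x, inhabited (iso (F x) y).

Definition weak_equivalence (C D : category) (F : functor C D) : Prop :=
  fully_faithful F /\ ess_surjective F.

Lemma arr_ind (C : category) (Q : forall x y : C, hom x y -> Prop)
    (x y x' y' : C) (f : hom x y) (f' : hom x' y') :
  f ≡ f' -> Q x y f -> Q x' y' f'.
Proof.
move=> h q; pose Q' (a : arrow C) := Q (adom a) (acod a) (aval a).
by change (Q' (Arr f')); rewrite -h.
Qed.

Lemma arr_inj (C : category) (x y : C) (f g : hom x y) : f ≡ g -> f = g.
Proof.
move=> h; pose Q x' y' (g' : hom x' y') :=
  forall (ex : x' = x) (ey : y' = y),
    f = eq_rect y' (hom x) (eq_rect x' (fun z => hom z y') g' x ex) y ey.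
suff /(_ erefl erefl) : Q x y g by [].
refine (arr_ind (Q := Q) h _) => ex ey.
by rewrite (proof_irrelevance _ ex erefl) (proof_irrelevance _ ey erefl).
Qed.

Lemma comp_arr (C : category) (x y z x' y' z' : C)
    (g : hom y z) (f : hom x y) (g' : hom y' z') (f' : hom x' y') :
  g ≡ g' -> f ≡ f' -> g ∘ f ≡ g' ∘ f'.
Proof.
move=> hg hf; move: z z' g g' hg.
apply: (arr_ind (Q := fun x' y' f' => forall z z' (g : hom y z) (g' : hom y' z'),
   g ≡ g' -> g ∘ f ≡ g' ∘ f') hf) => z z' g g' hg.
have ez : z = z' by have := congr1 (@acod C) hg.
by case: z' / ez g' hg => g' /arr_inj ->.
Qed.

Lemma fmap_arr (C D : category) (F : functor C D) (x y x' y' : C)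
    (f : hom x y) (f' : hom x' y') : f ≡ f' -> fmap F f ≡ fmap F f'.
Proof.
move=> h.
by apply: (arr_ind (Q := fun x' y' f' => fmap F f ≡ fmap F f') h).
Qed.

Lemma idc_arr (C : category) (x y : C) : x = y -> idc x ≡ idc y.
Proof. by case: y /. Qed.

Definition iso_id (C : category) (x : C) : iso x x :=
  Iso (comp1f (idc x)) (comp1f (idc x)).

Definition iso_comp (C : category) (x y z : C) (g : iso y z) (f : iso x y) :
  iso x z.
Proof.
refine (@Iso C x z (g ∘ f) (isoV f ∘ isoV g) _ _).
- by rewrite compA -(compA (isoV f)) isoVK compf1 isoVK.
- by rewrite compA -(compA g) isoK compf1 isoK.
Defined.

Definition iso_inv (C : category) (x y : C) (f : iso x y) : iso y x :=
  Iso (isoK f) (isoVK f).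

Definition iso_fmap (C D : category) (F : functor C D) (x y : C) (f : iso x y) :
  iso (F x) (F y).
Proof.
refine (@Iso D (F x) (F y) (fmap F f) (fmap F (isoV f)) _ _).
- by rewrite -fmapM isoVK fmap1.
- by rewrite -fmapM isoK fmap1.
Defined.

Record pb_ob (A B C : category) (F : functor A C) (G : functor B C) := PbOb {
  pb1 : A;
  pb2 : B;
  pbE : F pb1 = G pb2 }.

Record pb_hom (A B C : category) (F : functor A C) (G : functor B C)
    (p q : pb_ob F G) := PbHom {
  pbh1 : hom (pb1 p) (pb1 q);
  pbh2 : hom (pb2 p) (pb2 q);
  pbhE : fmap F pbh1 ≡ fmap G pbh2 }.

Lemma pb_hom_eq (A B C : category) (F : functor A C) (G : functor B C)
    (p q : pb_ob F G) (f g : pb_hom p q) :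
  pbh1 f = pbh1 g -> pbh2 f = pbh2 g -> f = g.
Proof.
case: f g => [f1 f2 fE] [g1 g2 gE] /= e1 e2; subst g1 g2.
by rewrite (proof_irrelevance _ fE gE).
Qed.

Definition pullback (A B C : category) (F : functor A C) (G : functor B C) :
  category.
Proof.
refine (@Category (pb_ob F G) (@pb_hom A B C F G)
  (fun p => @PbHom _ _ _ F G p p (idc (pb1 p)) (idc (pb2 p)) _)
  (fun p q r g f => @PbHom _ _ _ F G p r (pbh1 g ∘ pbh1 f) (pbh2 g ∘ pbh2 f) _)
  _ _ _).
Unshelve.
- by move=> p q f; apply: pb_hom_eq => /=; rewrite comp1f.
- by move=> p q f; apply: pb_hom_eq => /=; rewrite compf1.
- by move=> p q r s h g f; apply: pb_hom_eq => /=; rewrite compA.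
- by rewrite !fmap1 (pbE p).
- by rewrite !fmapM; apply: comp_arr; exact: pbhE.
Defined.

Definition pb_pr2 (A B C : category) (F : functor A C) (G : functor B C) :
  functor (pullback F G) B :=
  @Functor (pullback F G) B (@pb2 A B C F G) (fun p q f => pbh2 f)
    (fun=> erefl) (fun _ _ _ _ _ => erefl).

Record fib_ob (C D : category) (F : functor C D) (x : D) := FibOb {
  fval :> C;
  fvalE : F fval = x }.

Record fib_hom (C D : category) (F : functor C D) (x : D) (a b : fib_ob F x) :=
  FibHom {
  fhval :> hom (fval a) (fval b);
  fhvalE : fmap F fhval ≡ idc x }.

Lemma fib_hom_eq (C D : category) (F : functor C D) (x : D) (a b : fib_ob F x)
    (f g : fib_hom a b) : fhval f = fhval g -> f = g.
Proof.
case: f g => [f fE] [g gE] /= e; subst g.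
by rewrite (proof_irrelevance _ fE gE).
Qed.

Definition fiber (C D : category) (F : functor C D) (x : D) : category.
Proof.
refine (@Category (fib_ob F x) (@fib_hom C D F x)
  (fun a => @FibHom _ _ F x a a (idc (fval a)) _)
  (fun a b c g f => @FibHom _ _ F x a c (fhval g ∘ fhval f) _) _ _ _).
Unshelve.
- by move=> a b f; apply: fib_hom_eq; rewrite /= comp1f.
- by move=> a b f; apply: fib_hom_eq; rewrite /= compf1.
- by move=> a b c d h g f; apply: fib_hom_eq; rewrite /= compA.
- by rewrite fmap1 (fvalE a).
- by rewrite fmapM (comp_arr (fhvalE g) (fhvalE f)) comp1f.
Defined.

Definition fmor (C D : category) (F : functor C D) (x : D) (a b : fiber F x)
  (f : hom a b) : hom (fval a) (fval b) := fhval f.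

Definition fib_inc (C D : category) (F : functor C D) (x : D) :
  functor (fiber F x) C :=
  @Functor (fiber F x) C (@fval C D F x) (fun a b f => fhval f)
    (fun=> erefl) (fun _ _ _ _ _ => erefl).

(** [lari_fun] is a section of [G] and is left adjoint to it with identity unit;
    [lari_tri1] and [lari_tri2] are the two triangle identities. *)
Record lari (A B : category) (G : functor A B) := Lari {
  lari_fun :> functor B A;
  lariK : functor_eq (functor_comp G lari_fun) (functor_id B);
  counit : forall t, hom (lari_fun (G t)) t;
  counit_nat : forall t t' (f : hom t t'),
    counit t' ∘ fmap lari_fun (fmap G f) = f ∘ counit t;
  lari_tri1 : forall t, fmap G (counit t) ≡ idc (G t);
  lari_tri2 : forall p, counit (lari_fun p) ≡ idc (lari_fun p) }.

(** The category of objects [tight], and the category of proarrows and cells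
    together with its source and target functors. A proarrow is indexed by its
    endpoints. A cell is not indexed by its side arrows: these are the values
    [cleft] and [cright] of the source and target functors on the cell. *)
Record dbl_base := DblBase {
  tight :> category;
  pro : tight -> tight -> Type;
  cell : forall x y x' y', pro x y -> pro x' y' -> Type;
  cid : forall x y (m : pro x y), cell m m;
  ccomp : forall x y x' y' x'' y''
    (m : pro x y) (m' : pro x' y') (m'' : pro x'' y''),
    cell m' m'' -> cell m m' -> cell m m'';
  ccomp1f : forall x y x' y' (m : pro x y) (m' : pro x' y') (α : cell m m'),
    ccomp (cid m') α = α;
  ccompf1 : forall x y x' y' (m : pro x y) (m' : pro x' y') (α : cell m m'),
    ccomp α (cid m) = α;
  ccompA : forall x y x' y' x'' y'' x3 y3
    (m : pro x y) (m' : pro x' y') (m'' : pro x'' y'') (m3 : pro x3 y3)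
    (γ : cell m'' m3) (β : cell m' m'') (α : cell m m'),
    ccomp γ (ccomp β α) = ccomp (ccomp γ β) α;
  cleft : forall x y x' y' (m : pro x y) (m' : pro x' y'), cell m m' -> hom x x';
  cright : forall x y x' y' (m : pro x y) (m' : pro x' y'), cell m m' -> hom y y';
  cleft1 : forall x y (m : pro x y), cleft (cid m) = idc x;
  cright1 : forall x y (m : pro x y), cright (cid m) = idc y;
  cleftM : forall x y x' y' x'' y''
    (m : pro x y) (m' : pro x' y') (m'' : pro x'' y'')
    (β : cell m' m'') (α : cell m m'), cleft (ccomp β α) = cleft β ∘ cleft α;
  crightM : forall x y x' y' x'' y''
    (m : pro x y) (m' : pro x' y') (m'' : pro x'' y'')
    (β : cell m' m'') (α : cell m m'),
    cright (ccomp β α) = cright β ∘ cright α }.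

Arguments pro {d} _ _.
Arguments cell {d x y x' y'} _ _.
Arguments cid {d x y} m.

Record loose (D : dbl_base) := Loose {
  lsrc : D;
  ltgt : D;
  lpro : pro lsrc ltgt }.

Definition D1 (D : dbl_base) : category :=
  @Category (loose D) (fun s t => cell (lpro s) (lpro t))
    (fun s => cid (lpro s)) (fun s t r β α => ccomp β α)
    (fun s t α => ccomp1f α) (fun s t α => ccompf1 α)
    (fun s t r q γ β α => ccompA γ β α).

Definition src (D : dbl_base) : functor (D1 D) D :=
  @Functor (D1 D) D (@lsrc D) (fun s t α => cleft α)
    (fun s => cleft1 (lpro s)) (fun s t r β α => cleftM β α).

Definition tgt (D : dbl_base) : functor (D1 D) D :=
  @Functor (D1 D) D (@ltgt D) (fun s t α => cright α)
    (fun s => cright1 (lpro s)) (fun s t r β α => crightM β α).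

Notation "β ∙ α" := (ccomp β α) : dbl_scope.

Definition ciso (D : dbl_base) (x y x' y' : D) (m : pro x y) (m' : pro x' y') :=
  iso (Loose m : D1 D) (Loose m').
Definition cfun (D : dbl_base) (x y x' y' : D) (m : pro x y) (m' : pro x' y')
  (i : ciso m m') : cell m m' := isof i.
Coercion cfun : ciso >-> cell.

Definition globular (D : dbl_base) (x y : D) (m m' : pro x y) (α : cell m m') :=
  cleft α = idc x /\ cright α = idc y.

(** [cunder α β e] is the loose composite of the cells [α] and [β]; it takes a
    proof [e] that the right arrow of [α] is the left arrow of [β]. In the axioms
    such proofs are universally quantified: they are always available, and any
    two of them are equal by proof irrelevance. *)
Record dblcat := DblCat {
  dbase :> dbl_base;
  pcomp : forall x y z : dbase, pro x y -> pro y z -> pro x z;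
  cunder : forall (x y z x' y' z' : dbase)
    (m : pro x y) (n : pro y z) (m' : pro x' y') (n' : pro y' z')
    (α : cell m m') (β : cell n n'),
    cright α = cleft β -> cell (pcomp m n) (pcomp m' n');
  cunder_left : forall (x y z x' y' z' : dbase)
    (m : pro x y) (n : pro y z) (m' : pro x' y') (n' : pro y' z')
    (α : cell m m') (β : cell n n') (e : cright α = cleft β),
    cleft (cunder e) = cleft α;
  cunder_right : forall (x y z x' y' z' : dbase)
    (m : pro x y) (n : pro y z) (m' : pro x' y') (n' : pro y' z')
    (α : cell m m') (β : cell n n') (e : cright α = cleft β),
    cright (cunder e) = cright β;
  cunder1 : forall (x y z : dbase) (m : pro x y) (n : pro y z)
    (e : cright (cid m) = cleft (cid n)), cunder e = cid (pcomp m n);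
  cunderM : forall (x y z x' y' z' x'' y'' z'' : dbase)
    (m : pro x y) (n : pro y z) (m' : pro x' y') (n' : pro y' z')
    (m'' : pro x'' y'') (n'' : pro y'' z'')
    (α : cell m m') (β : cell n n') (α' : cell m' m'') (β' : cell n' n'')
    (e : cright α = cleft β) (e' : cright α' = cleft β')
    (e'' : cright (α' ∙ α) = cleft (β' ∙ β)),
    cunder e'' = (cunder e' ∙ cunder e);
  pid : forall x : dbase, pro x x;
  pidc : forall (x y : dbase) (f : hom x y), cell (pid x) (pid y);
  pidc_left : forall (x y : dbase) (f : hom x y), cleft (pidc f) = f;
  pidc_right : forall (x y : dbase) (f : hom x y), cright (pidc f) = f;
  pidc1 : forall x : dbase, pidc (idc x) = cid (pid x);
  pidcM : forall (x y z : dbase) (g : hom y z) (f : hom x y),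
    pidc (g ∘ f) = (pidc g ∙ pidc f);
  assoc : forall (x y z w : dbase) (m : pro x y) (n : pro y z) (p : pro z w),
    ciso (pcomp (pcomp m n) p) (pcomp m (pcomp n p));
  lunit : forall (x y : dbase) (m : pro x y), ciso (pcomp (pid x) m) m;
  runit : forall (x y : dbase) (m : pro x y), ciso (pcomp m (pid y)) m;
  assoc_glob : forall (x y z w : dbase)
    (m : pro x y) (n : pro y z) (p : pro z w), globular (assoc m n p);
  lunit_glob : forall (x y : dbase) (m : pro x y), globular (lunit m);
  runit_glob : forall (x y : dbase) (m : pro x y), globular (runit m);
  assoc_nat : forall (x y z w x' y' z' w' : dbase)
    (m : pro x y) (n : pro y z) (p : pro z w)
    (m' : pro x' y') (n' : pro y' z') (p' : pro z' w')
    (α : cell m m') (β : cell n n') (γ : cell p p')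
    (e1 : cright α = cleft β) (e2 : cright β = cleft γ)
    (e3 : cright (cunder e1) = cleft γ) (e4 : cright α = cleft (cunder e2)),
    (assoc m' n' p' ∙ cunder e3) = (cunder e4 ∙ assoc m n p);
  lunit_nat : forall (x y x' y' : dbase) (m : pro x y) (m' : pro x' y')
    (α : cell m m') (e : cright (pidc (cleft α)) = cleft α),
    (lunit m' ∙ cunder e) = (α ∙ lunit m);
  runit_nat : forall (x y x' y' : dbase) (m : pro x y) (m' : pro x' y')
    (α : cell m m') (e : cright α = cleft (pidc (cright α))),
    (runit m' ∙ cunder e) = (α ∙ runit m);
  pentagon : forall (x y z w v : dbase)
    (m : pro x y) (n : pro y z) (p : pro z w) (q : pro w v)
    (e1 : cright (cid m) = cleft (assoc n p q))
    (e2 : cright (assoc m n p) = cleft (cid q)),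
    (assoc m n (pcomp p q) ∙ assoc (pcomp m n) p q) =
    (cunder e1 ∙ assoc m (pcomp n p) q ∙ cunder e2);
  triangle : forall (x y z : dbase) (m : pro x y) (n : pro y z)
    (e1 : cright (cid m) = cleft (lunit n))
    (e2 : cright (runit m) = cleft (cid n)),
    (cunder e1 ∙ assoc m (pid y) n) = cunder e2 }.

Arguments pid {d} x.
Arguments pidc {d x y} f.
Arguments cunder {d x y z x' y' z' m n m' n'} α β _.
Notation "s ⊙ t" := (pcomp s t) : dbl_scope.

Record dfunctor (E B : dblcat) := DFunctor {
  F0 :> functor E B;
  Fpro : forall a b : E, pro a b -> pro (F0 a) (F0 b);
  Fcell : forall (a b a' b' : E) (s : pro a b) (s' : pro a' b'),
    cell s s' -> cell (Fpro s) (Fpro s');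
  Fcell1 : forall (a b : E) (s : pro a b), Fcell (cid s) = cid (Fpro s);
  FcellM : forall (a b a' b' a'' b'' : E)
    (s : pro a b) (s' : pro a' b') (s'' : pro a'' b'')
    (β : cell s' s'') (α : cell s s'),
    Fcell (β ∙ α) = (Fcell β ∙ Fcell α);
  Fcell_left : forall (a b a' b' : E) (s : pro a b) (s' : pro a' b')
    (α : cell s s'), cleft (Fcell α) = fmap F0 (cleft α);
  Fcell_right : forall (a b a' b' : E) (s : pro a b) (s' : pro a' b')
    (α : cell s s'), cright (Fcell α) = fmap F0 (cright α);
  Fcomp : forall (a b c : E) (s : pro a b) (t : pro b c),
    ciso (Fpro s ⊙ Fpro t) (Fpro (s ⊙ t));
  Fid : forall a : E, ciso (pid (F0 a)) (Fpro (pid a));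
  Fcomp_glob : forall (a b c : E) (s : pro a b) (t : pro b c),
    globular (Fcomp s t);
  Fid_glob : forall a : E, globular (Fid a);
  Fcomp_nat : forall (a b c a' b' c' : E)
    (s : pro a b) (t : pro b c) (s' : pro a' b') (t' : pro b' c')
    (α : cell s s') (β : cell t t')
    (e : cright α = cleft β) (e' : cright (Fcell α) = cleft (Fcell β)),
    (Fcomp s' t' ∙ cunder (Fcell α) (Fcell β) e') =
    (Fcell (cunder α β e) ∙ Fcomp s t);
  Fid_nat : forall (a b : E) (u : hom a b),
    (Fid b ∙ pidc (fmap F0 u)) = (Fcell (pidc u) ∙ Fid a);
  Fassoc : forall (a b c d : E) (s : pro a b) (t : pro b c) (r : pro c d)
    (e1 : cright (Fcomp s t) = cleft (cid (Fpro r)))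
    (e2 : cright (cid (Fpro s)) = cleft (Fcomp t r)),
    (Fcell (assoc s t r) ∙ Fcomp (s ⊙ t) r ∙ cunder (Fcomp s t) _ e1) =
    (Fcomp s (t ⊙ r) ∙ cunder _ (Fcomp t r) e2
      ∙ assoc (Fpro s) (Fpro t) (Fpro r));
  Flunit : forall (a b : E) (t : pro a b)
    (e : cright (Fid a) = cleft (cid (Fpro t))),
    (Fcell (lunit t) ∙ Fcomp (pid a) t ∙ cunder (Fid a) _ e) =
    lunit (Fpro t);
  Frunit : forall (a b : E) (t : pro a b)
    (e : cright (cid (Fpro t)) = cleft (Fid b)),
    (Fcell (runit t) ∙ Fcomp t (pid b) ∙ cunder _ (Fid b) e) =
    runit (Fpro t) }.

Arguments Fpro {E B} P {a b} s : rename.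
Arguments Fcell {E B} P {a b a' b' s s'} α : rename.
Arguments Fcomp {E B} P {a b c} s t : rename.
Arguments Fid {E B} P a : rename.

Definition F1 (E B : dblcat) (P : dfunctor E B) : functor (D1 E) (D1 B) :=
  @Functor (D1 E) (D1 B) (fun s => Loose (Fpro P (lpro s)))
    (fun s t α => Fcell P α)
    (fun s => Fcell1 P (lpro s)) (fun s t r β α => FcellM P β α).

Lemma cunder_eq (D : dblcat) (x y z x' y' z' : D)
    (m : pro x y) (n : pro y z) (m' : pro x' y') (n' : pro y' z')
    (α α' : cell m m') (β β' : cell n n')
    (e : cright α = cleft β) (e' : cright α' = cleft β') :
  α = α' -> β = β' -> cunder α β e = cunder α' β' e'.
Proof.
by move=> ea eb; subst α' β'; rewrite (proof_irrelevance _ e e').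
Qed.

Lemma cunderMl (D : dblcat) (x y z x' x'' : D)
    (m : pro x y) (n : pro y z) (m' : pro x' y)
    (m'' : pro x'' y)
    (α : cell m m') (α' : cell m' m'')
    (e : cright (α' ∙ α) = cleft (cid n))
    (e1 : cright α = cleft (cid n)) (e2 : cright α' = cleft (cid n)) :
  cunder (α' ∙ α) (cid n) e = cunder α' (cid n) e2 ∙ cunder α (cid n) e1.
Proof.
have e3 : cright (α' ∙ α) = cleft (cid n ∙ cid n) by rewrite ccomp1f.
rewrite -(cunderM e1 e2 e3); apply: cunder_eq => //; by rewrite ccomp1f.
Qed.

Lemma cunderMr (D : dblcat) (x y z z' z'' : D)
    (m : pro x y) (n : pro y z) (n' : pro y z') (n'' : pro y z'')
    (β : cell n n') (β' : cell n' n'')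
    (e : cright (cid m) = cleft (β' ∙ β))
    (e1 : cright (cid m) = cleft β) (e2 : cright (cid m) = cleft β') :
  cunder (cid m) (β' ∙ β) e = cunder (cid m) β' e2 ∙ cunder (cid m) β e1.
Proof.
have e3 : cright (cid m ∙ cid m) = cleft (β' ∙ β) by rewrite ccomp1f.
rewrite -(cunderM e1 e2 e3); apply: cunder_eq => //; by rewrite ccomp1f.
Qed.

Definition comp_cmp (C D E : dblcat) (G : dfunctor D E) (F : dfunctor C D)
    (a b c : C) (s : pro a b) (t : pro b c) :
    ciso (Fpro G (Fpro F s) ⊙ Fpro G (Fpro F t)) (Fpro G (Fpro F (s ⊙ t))) :=
  iso_comp (iso_fmap (F1 G) (Fcomp F s t)) (Fcomp G (Fpro F s) (Fpro F t)).

Definition comp_cmp0 (C D E : dblcat) (G : dfunctor D E) (F : dfunctor C D)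
    (a : C) : ciso (pid (G (F a))) (Fpro G (Fpro F (pid a))) :=
  iso_comp (iso_fmap (F1 G) (Fid F a)) (Fid G (F a)).

Lemma comp_cmpE (C D E : dblcat) (G : dfunctor D E) (F : dfunctor C D)
    (a b c : C) (s : pro a b) (t : pro b c) :
  comp_cmp G F s t =
  Fcell G (Fcomp F s t) ∙ Fcomp G (Fpro F s) (Fpro F t) :> cell _ _.
Proof. by []. Qed.

Lemma comp_cmp0E (C D E : dblcat) (G : dfunctor D E) (F : dfunctor C D) (a : C) :
  comp_cmp0 G F a = Fcell G (Fid F a) ∙ Fid G (F a) :> cell _ _.
Proof. by []. Qed.

Definition dfunctor_comp (C D E : dblcat) (G : dfunctor D E) (F : dfunctor C D) :
  dfunctor C E.
Proof.
refine (@DFunctor C E (functor_comp G F) (fun a b s => Fpro G (Fpro F s))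
  (fun _ _ _ _ _ _ α => Fcell G (Fcell F α)) _ _ _ _
  (@comp_cmp _ _ _ G F) (comp_cmp0 G F) _ _ _ _ _ _ _).
- by move=> *; rewrite !Fcell1.
- by move=> *; rewrite !FcellM.
- by move=> *; rewrite !Fcell_left.
- by move=> *; rewrite !Fcell_right.
- move=> a b c s t; rewrite comp_cmpE; split.
    rewrite cleftM Fcell_left (Fcomp_glob _ _ _).1 (Fcomp_glob _ _ _).1.
    by rewrite fmap1 comp1f.
  rewrite crightM Fcell_right (Fcomp_glob _ _ _).2 (Fcomp_glob _ _ _).2.
  by rewrite fmap1 comp1f.
- move=> a; rewrite comp_cmp0E; split.
    rewrite cleftM Fcell_left (Fid_glob _ _).1 (Fid_glob _ _).1.
    by rewrite fmap1 comp1f.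
  rewrite crightM Fcell_right (Fid_glob _ _).2 (Fid_glob _ _).2.
  by rewrite fmap1 comp1f.
- move=> a b c a' b' c' s t s' t' α β e e'; rewrite !comp_cmpE.
  have e1 : cright (Fcell F α) = cleft (Fcell F β).
    by rewrite Fcell_right Fcell_left e.
  rewrite -ccompA (Fcomp_nat e1) ccompA -FcellM (Fcomp_nat e e1).
  by rewrite FcellM -ccompA.
- move=> a b u; rewrite !comp_cmp0E /=.
  by rewrite -ccompA Fid_nat ccompA -FcellM Fid_nat FcellM -ccompA.
- move=> a b c d s t r e1 e2.
  have [gl gr] := Fcomp_glob F s t; have [gl' gr'] := Fcomp_glob F t r.
  have f1 : cright (Fcomp F s t) = cleft (cid (Fpro F r)) by rewrite gr cleft1.
  have f2 : cright (cid (Fpro F s)) = cleft (Fcomp F t r).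
    by rewrite gl' cright1.
  have f3 : cright (Fcell G (Fcomp F s t)) = cleft (Fcell G (cid (Fpro F r))).
    by rewrite Fcell_right Fcell_left f1.
  have f4 : cright (Fcell G (cid (Fpro F s))) = cleft (Fcell G (Fcomp F t r)).
    by rewrite Fcell_right Fcell_left f2.
  have f5 : cright (Fcell G (Fcomp F s t)) = cleft (cid (Fpro G (Fpro F r))).
    by rewrite f3 Fcell1.
  have f6 : cright (cid (Fpro G (Fpro F s))) = cleft (Fcell G (Fcomp F t r)).
    by rewrite -f4 Fcell1.
  have f7 : cright (Fcomp G (Fpro F s) (Fpro F t)) =
      cleft (cid (Fpro G (Fpro F r))).
    by rewrite (Fcomp_glob _ _ _).2 cleft1.
  have f8 : cright (cid (Fpro G (Fpro F s))) =
      cleft (Fcomp G (Fpro F t) (Fpro F r)).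
    by rewrite (Fcomp_glob _ _ _).1 cright1.
  have g1 : cunder (Fcell G (Fcomp F s t)) (cid _) f5 =
      cunder (Fcell G (Fcomp F s t)) (Fcell G (cid (Fpro F r))) f3.
    by apply: cunder_eq; rewrite ?Fcell1.
  have g2 : cunder (cid _) (Fcell G (Fcomp F t r)) f6 =
      cunder (Fcell G (cid (Fpro F s))) (Fcell G (Fcomp F t r)) f4.
    by apply: cunder_eq; rewrite ?Fcell1.
  move: e1 e2; rewrite !comp_cmpE => e1 e2.
  rewrite (cunderMl e1 f7 f5) (cunderMr e2 f8 f6) g1 g2.
  rewrite !ccompA -(ccompA _ (Fcomp G _ _)) (Fcomp_nat f1 f3).
  rewrite -(ccompA _ (Fcomp G _ _) (cunder _ _ f4)) (Fcomp_nat f2 f4).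
  rewrite !ccompA -!FcellM (Fassoc f1 f2) !FcellM -!ccompA; congr (_ ∙ (_ ∙ _)).
  by rewrite !ccompA (Fassoc f7 f8) -!ccompA.
- move=> a b t e.
  have f1 : cright (Fid F a) = cleft (cid (Fpro F t)).
    by rewrite (Fid_glob _ _).2 cleft1.
  have f3 : cright (Fcell G (Fid F a)) = cleft (Fcell G (cid (Fpro F t))).
    by rewrite Fcell_right Fcell_left f1.
  have f5 : cright (Fcell G (Fid F a)) = cleft (cid (Fpro G (Fpro F t))).
    by rewrite f3 Fcell1.
  have f7 : cright (Fid G (F a)) = cleft (cid (Fpro G (Fpro F t))).
    by rewrite (Fid_glob _ _).2 cleft1.
  have g1 : cunder (Fcell G (Fid F a)) (cid _) f5 =
      cunder (Fcell G (Fid F a)) (Fcell G (cid (Fpro F t))) f3.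
    by apply: cunder_eq; rewrite ?Fcell1.
  move: e; rewrite comp_cmpE comp_cmp0E => e.
  rewrite (cunderMl e f7 f5) g1.
  rewrite !ccompA -(ccompA _ (Fcomp G _ _)) (Fcomp_nat f1 f3).
  by rewrite !ccompA -!FcellM (Flunit f1) (Flunit f7).
- move=> a b t e.
  have f1 : cright (cid (Fpro F t)) = cleft (Fid F b).
    by rewrite (Fid_glob _ _).1 cright1.
  have f3 : cright (Fcell G (cid (Fpro F t))) = cleft (Fcell G (Fid F b)).
    by rewrite Fcell_right Fcell_left f1.
  have f5 : cright (cid (Fpro G (Fpro F t))) = cleft (Fcell G (Fid F b)).
    by rewrite -f3 Fcell1.
  have f7 : cright (cid (Fpro G (Fpro F t))) = cleft (Fid G (F b)).
    by rewrite (Fid_glob _ _).1 cright1.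
  have g1 : cunder (cid _) (Fcell G (Fid F b)) f5 =
      cunder (Fcell G (cid (Fpro F t))) (Fcell G (Fid F b)) f3.
    by apply: cunder_eq; rewrite ?Fcell1.
  move: e; rewrite comp_cmpE comp_cmp0E => e.
  rewrite (cunderMr e f7 f5) g1.
  rewrite !ccompA -(ccompA _ (Fcomp G _ _)) (Fcomp_nat f1 f3).
  by rewrite !ccompA -!FcellM (Frunit f1) (Frunit f7).
Defined.


Notation "α ≣ β" := (Arr (α : @hom (D1 _) (Loose _) (Loose _)) =
                     Arr (β : @hom (D1 _) (Loose _) (Loose _))) : dbl_scope.

Definition dfunctor_eq (E B : dblcat) (P Q : dfunctor E B) : Prop :=
  [/\ functor_eq P Q,
      functor_eq (F1 P) (F1 Q),
      (forall (a b c : E) (s : pro a b) (t : pro b c),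
        cfun (Fcomp P s t) ≣ cfun (Fcomp Q s t)) &
      (forall a : E, cfun (Fid P a) ≣ cfun (Fid Q a))].

Definition srcP_ob (E B : dblcat) (P : dfunctor E B) (s : D1 E) :
    pullback P (src B) :=
  @PbOb _ _ _ P (src B) (lsrc s) (F1 P s) erefl.

(** The functor [<src, P_1>]. *)
Definition srcP (E B : dblcat) (P : dfunctor E B) :
  functor (D1 E) (pullback P (src B)).
Proof.
refine (@Functor (D1 E) (pullback P (src B))
  (srcP_ob P)
  (fun s t α => @PbHom _ _ _ P (src B) (srcP_ob P s) (srcP_ob P t) (cleft α) (Fcell P α) _) _ _).
Unshelve.
- by move=> s; apply: pb_hom_eq => /=; rewrite ?cleft1 ?Fcell1.
- by move=> s t r β α; apply: pb_hom_eq => /=; rewrite ?cleftM ?FcellM.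
- by rewrite /= Fcell_left.
Defined.

Definition loosely_discrete_opfibration (E B : dblcat) (P : dfunctor E B) :=
  weak_equivalence (srcP P).

Section Transition.
Context (E B : dblcat) (P : dfunctor E B) (σ : lari (srcP P)).

Definition lift_ob (x y : B) (a : fiber P x) (m : pro x y) :
  pullback P (src B) :=
  @PbOb _ _ _ P (src B) (fval a) (Loose m) (fvalE a).

Definition lift_hom (x y x' y' : B) (a : fiber P x) (a' : fiber P x')
    (m : pro x y) (m' : pro x' y') (u : hom (fval a) (fval a'))
    (θ : cell m m') (h : fmap P u ≡ cleft θ) :
    hom (lift_ob a m) (lift_ob a' m') :=
  @PbHom _ _ _ P (src B) (lift_ob a m) (lift_ob a' m') u θ h.

Lemma push_subproof (x y : B) (a : fiber P x) (m : pro x y) :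
  P (ltgt (σ (lift_ob a m))) = y.
Proof.
exact (congr1 (functor_comp (tgt B) (pb_pr2 P (src B)))
         ((lariK σ).1 (lift_ob a m))).
Qed.

(** The pair [(a, m)] with [P a = src m] is presented as an object [a] of the
    fibre over [x] and [m : pro x y]; [push a m] is [m_!(a) = tgt σ(a, m)]. *)
Definition push (x y : B) (a : fiber P x) (m : pro x y) : fiber P y :=
  FibOb (push_subproof a m).

(** [θ_!(u) = tgt σ(u, θ)] *)
Definition push1 (x y x' y' : B) (a : fiber P x) (a' : fiber P x')
    (m : pro x y) (m' : pro x' y') (u : hom (fval a) (fval a'))
    (θ : cell m m') (h : fmap P u ≡ cleft θ) :
    hom (fval (push a m)) (fval (push a' m')) :=
  cright (fmap σ (lift_hom h)).
Arguments push1 {x y x' y' a a' m m'} u θ h.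

Lemma push1_over (x y x' y' : B) (a : fiber P x) (a' : fiber P x')
    (m : pro x y) (m' : pro x' y') (u : hom (fval a) (fval a'))
    (θ : cell m m') (h : fmap P u ≡ cleft θ) :
  fmap P (push1 u θ h) ≡ cright θ.
Proof.
have := (lariK σ).2 _ _ (lift_hom h).
move/(fmap_arr (functor_comp (tgt B) (pb_pr2 P (src B)))) => /= <-.
by rewrite /push1 Fcell_right.
Qed.

Lemma push1_1 (x y : B) (a : fiber P x) (m : pro x y)
    (h : fmap P (idc (fval a)) ≡ cleft (cid m)) :
  push1 (idc (fval a)) (cid m) h = idc _.
Proof.
rewrite /push1 -[RHS](cright1 (lpro (σ (lift_ob a m)))).
have -> : lift_hom h = idc (lift_ob a m) by apply: pb_hom_eq.
by rewrite fmap1.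
Qed.

Lemma push1M (x y x' y' x'' y'' : B)
    (a : fiber P x) (a' : fiber P x') (a'' : fiber P x'')
    (m : pro x y) (m' : pro x' y') (m'' : pro x'' y'')
    (u : hom (fval a) (fval a')) (v : hom (fval a') (fval a''))
    (θ : cell m m') (φ : cell m' m'')
    (h : fmap P u ≡ cleft θ) (h' : fmap P v ≡ cleft φ)
    (h'' : fmap P (v ∘ u) ≡ cleft (φ ∙ θ)) :
  push1 (v ∘ u) (φ ∙ θ) h'' = push1 v φ h' ∘ push1 u θ h.
Proof.
rewrite /push1 -crightM.
have -> : lift_hom h'' = lift_hom h' ∘ lift_hom h.
  by apply: pb_hom_eq.
by rewrite fmapM.
Qed.

Lemma push1_eq (x y x' y' : B) (a : fiber P x) (a' : fiber P x')
    (m : pro x y) (m' : pro x' y') (u u' : hom (fval a) (fval a'))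
    (θ θ' : cell m m') (h : fmap P u ≡ cleft θ) (h' : fmap P u' ≡ cleft θ') :
  u = u' -> θ = θ' -> push1 u θ h = push1 u' θ' h'.
Proof.
by move=> eu eθ; subst u' θ'; rewrite (proof_irrelevance _ h h').
Qed.

Lemma push1_cidl (x y x' y' : B)
    (a : fiber P x) (a' a'' : fiber P x') (m : pro x y) (m' : pro x' y')
    (u : hom (fval a) (fval a')) (v : hom (fval a') (fval a''))
    (θ : cell m m') (h : fmap P u ≡ cleft θ) (h' : fmap P v ≡ cleft (cid m'))
    (h'' : fmap P (v ∘ u) ≡ cleft θ) :
  push1 v (cid m') h' ∘ push1 u θ h = push1 (v ∘ u) θ h''.
Proof.
have k : fmap P (v ∘ u) ≡ cleft (cid m' ∙ θ) by rewrite ccomp1f.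
by rewrite -(push1M h h' k); apply: push1_eq; rewrite ?ccomp1f.
Qed.

Lemma push1_cidr (x y x' y' : B)
    (a a' : fiber P x) (a'' : fiber P x') (m : pro x y) (m' : pro x' y')
    (u : hom (fval a) (fval a')) (v : hom (fval a') (fval a''))
    (θ : cell m m') (h : fmap P u ≡ cleft (cid m)) (h' : fmap P v ≡ cleft θ)
    (h'' : fmap P (v ∘ u) ≡ cleft θ) :
  push1 v θ h' ∘ push1 u (cid m) h = push1 (v ∘ u) θ h''.
Proof.
have k : fmap P (v ∘ u) ≡ cleft (θ ∙ cid m) by rewrite ccompf1.
by rewrite -(push1M h h' k); apply: push1_eq; rewrite ?ccompf1.
Qed.

Lemma fib_cid (x y : B) (a a' : fiber P x) (m : pro x y) (u : hom a a') :
  fmap P (fhval u) ≡ cleft (cid m).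
Proof. by rewrite cleft1; exact: fhvalE. Qed.

Lemma idc_glob (x y : B) (a : fiber P x) (m m' : pro x y) (α : cell m m') :
  globular α -> fmap P (idc (fval a)) ≡ cleft α.
Proof. by case=> -> _; rewrite fmap1 (fvalE a). Qed.

(** The functor [m_!] between fibres: [m_!(u) = tgt σ(u, 1_m)]. *)
Definition trans (x y : B) (m : pro x y) : functor (fiber P x) (fiber P y).
Proof.
refine (@Functor (fiber P x) (fiber P y) (fun a => push a m)
  (fun a a' u => @FibHom _ _ P y (push a m) (push a' m)
    (push1 (fhval u) (cid m) (fib_cid m u)) _) _ _).
Unshelve.
- by move=> a; apply: fib_hom_eq; rewrite /= push1_1.
- move=> a b c v u; apply: fib_hom_eq => /=.
  have h : fmap P (fhval v ∘ fhval u) ≡ cleft (cid m ∙ cid m).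
    by rewrite ccomp1f; exact: (fib_cid m (comp (c := fiber P x) v u)).
  rewrite -(push1M (fib_cid m u) (fib_cid m v) h).
  by apply: push1_eq; rewrite ?ccomp1f.
- by rewrite push1_over cright1.
Defined.

(** [α_!(1_a)] for a globular cell [α]. *)
Definition gpush (x y : B) (a : fiber P x) (m m' : pro x y) (α : cell m m')
    (g : globular α) : hom (push a m) (push a m') :=
  @FibHom _ _ P y (push a m) (push a m')
    (push1 (idc (fval a)) α (idc_glob a g))
    (etrans (push1_over (idc_glob a g)) (congr1 _ g.2)).

Definition own_fib (a : E) : fiber P (P a) := FibOb (erefl (P a)).

Lemma counit_subproof (a b : E) (t : pro a b) :
  fmap P (cright (counit σ (Loose t : D1 E))) ≡ idc (P b).
Proof.
have /(fmap_arr (functor_comp (tgt B) (pb_pr2 P (src B)))) /= :=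
  lari_tri1 σ (Loose t).
by rewrite Fcell_right cright1.
Qed.

(** [tgt ε_t : (P t)_!(a) -> b] *)
Definition tcounit (a b : E) (t : pro a b) :
    hom (push (own_fib a) (Fpro P t)) (own_fib b) :=
  @FibHom _ _ P (P b) (push (own_fib a) (Fpro P t)) (own_fib b)
    (cright (counit σ (Loose t : D1 E))) (counit_subproof t).

End Transition.

Arguments push1 {E B P} σ {x y x' y' a a' m m'} u θ h.

(** [mu a m n : n_!m_!(a) -> (m ⊙ n)_!(a)] and [kappa a : a -> (id)_!(a)] are
    isomorphisms of fibres, that is, isomorphisms of [E] sent by [P] to
    identities. They are natural with respect to all arrows of [E], not only to
    those of the fibres. *)
Record cleavage (E B : dblcat) (P : dfunctor E B) := Cleavage {
  sigma :> lari (srcP P);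
  mu : forall (x y z : B) (a : fiber P x) (m : pro x y) (n : pro y z),
    iso (push sigma (push sigma a m) n) (push sigma a (m ⊙ n));
  kappa : forall (x : B) (a : fiber P x), iso a (push sigma a (pid x));
  mu_nat : forall (x y z x' y' z' : B) (a : fiber P x) (a' : fiber P x')
    (m : pro x y) (n : pro y z) (m' : pro x' y') (n' : pro y' z')
    (u : hom (fval a) (fval a')) (θ : cell m m') (φ : cell n n')
    (h : fmap P u ≡ cleft θ) (e : cright θ = cleft φ)
    (h1 : fmap P (push1 sigma u θ h) ≡ cleft φ)
    (h2 : fmap P u ≡ cleft (cunder θ φ e)),
    fmor (mu a' m' n') ∘ push1 sigma (push1 sigma u θ h) φ h1 =
    push1 sigma u (cunder θ φ e) h2 ∘ fmor (mu a m n);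
  kappa_nat : forall (x x' : B) (a : fiber P x) (a' : fiber P x')
    (f : hom x x') (u : hom (fval a) (fval a'))
    (h : fmap P u ≡ cleft (pidc f)),
    fmor (kappa a') ∘ u = push1 sigma u (pidc f) h ∘ fmor (kappa a);
  mu_assoc : forall (x y z w : B) (a : fiber P x)
    (m : pro x y) (n : pro y z) (p : pro z w),
    gpush sigma a (assoc_glob m n p) ∘ mu a (m ⊙ n) p
      ∘ fmap (trans sigma p) (mu a m n) =
    mu a m (n ⊙ p) ∘ mu (push sigma a m) n p;
  mu_runit : forall (x y : B) (a : fiber P x) (m : pro x y),
    gpush sigma a (runit_glob m) ∘ mu a m (pid y)
      ∘ kappa (push sigma a m) = idc (push sigma a m);
  mu_lunit : forall (x y : B) (a : fiber P x) (m : pro x y),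
    gpush sigma a (lunit_glob m) ∘ mu a (pid x) m
      ∘ fmap (trans sigma m) (kappa a) = idc (push sigma a m);
  counit_assoc : forall (a b c : E) (s : pro a b) (t : pro b c),
    tcounit sigma (s ⊙ t) ∘ gpush sigma (own_fib P a) (Fcomp_glob P s t)
      ∘ mu (own_fib P a) (Fpro P s) (Fpro P t) =
    tcounit sigma t ∘ fmap (trans sigma (Fpro P t)) (tcounit sigma s);
  counit_unit : forall a : E,
    tcounit sigma (pid a) ∘ gpush sigma (own_fib P a) (Fid_glob P a)
      ∘ kappa (own_fib P a) = idc (own_fib P a) }.

Lemma isoVr (C : category) (x y z : C) (f : iso x y) (g h : hom y z) :
  g ∘ f = h ∘ f -> g = h.
Proof.
by move=> e; rewrite -(compf1 g) -(compf1 h) -(isoK f) !compA e.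
Qed.

Lemma iso_comp_invK (C : category) (x y z : C) (f : iso y z) (h : iso y x) :
  iso_comp f (iso_inv h) ∘ h = f.
Proof. by rewrite /= -compA isoVK compf1. Qed.

Section Elements.
Context (E B : dblcat) (P : dfunctor E B) (C : cleavage P).

Record elt_ob := EltOb { ex : B; ea : fiber P ex }.

Record elt_hom (X Y : elt_ob) := EltHom {
  ef : hom (ex X) (ex Y);
  eu : hom (fval (ea X)) (fval (ea Y));
  euE : fmap P eu ≡ ef }.

Lemma elt_hom_eq (X Y : elt_ob) (f g : elt_hom X Y) :
  ef f = ef g -> eu f = eu g -> f = g.
Proof.
case: f g => [f u h] [g v k] /= e1 e2; subst g v.
by rewrite (proof_irrelevance _ h k).
Qed.

Definition elt_tight : category.
Proof.
refine (@Category elt_ob elt_hom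
  (fun X => @EltHom X X (idc (ex X)) (idc (fval (ea X))) _)
  (fun X Y Z g f => @EltHom X Z (ef g ∘ ef f) (eu g ∘ eu f) _) _ _ _).
Unshelve.
- by move=> X Y f; apply: elt_hom_eq; rewrite /= comp1f.
- by move=> X Y f; apply: elt_hom_eq; rewrite /= compf1.
- by move=> X Y Z W h g f; apply: elt_hom_eq; rewrite /= compA.
- by rewrite fmap1 (fvalE (ea X)).
- by rewrite fmapM; apply: comp_arr; exact: euE.
Defined.

Record elt_pro (X Y : elt_ob) := EltPro {
  em : pro (ex X) (ex Y);
  ebar : iso (push C (ea X) em) (ea Y) }.

Lemma elt_subproof (X X' : elt_ob) (y y' : B) (m : pro (ex X) y)
    (m' : pro (ex X') y') (f : elt_hom X X') (α : cell m m') :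
  cleft α = ef f -> fmap P (eu f) ≡ cleft α.
Proof. by move->; exact: euE. Qed.

Record elt_cell (X Y X' Y' : elt_ob) (s : elt_pro X Y) (t : elt_pro X' Y') :=
  EltCell {
  el : elt_hom X X';
  er : elt_hom Y Y';
  ec : cell (em s) (em t);
  ecl : cleft ec = ef el;
  ecr : cright ec = ef er;
  ecE : fmor (ebar t) ∘ push1 C (eu el) ec (elt_subproof ecl) =
        eu er ∘ fmor (ebar s) }.

Lemma elt_cell_eq (X Y X' Y' : elt_ob) (s : elt_pro X Y) (t : elt_pro X' Y')
    (α β : elt_cell s t) :
  el α = el β -> er α = er β -> ec α = ec β -> α = β.
Proof.
case: α β => [l r c h1 h2 h3] [l' r' c' h1' h2' h3'] /= e1 e2 e3.
subst l' r' c'; move: h3 h3'.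
rewrite (proof_irrelevance _ h1 h1') (proof_irrelevance _ h2 h2') => h3 h3'.
by rewrite (proof_irrelevance _ h3 h3').
Qed.

Definition elt_cid (X Y : elt_ob) (s : elt_pro X Y) : elt_cell s s.
Proof.
refine (@EltCell X Y X Y s s (idc (X : elt_tight)) (idc (Y : elt_tight))
  (cid (em s)) (cleft1 _) (cright1 _) _).
abstract by rewrite push1_1 /= compf1 comp1f.
Defined.

Lemma elt_ccomp_l (X Y X' Y' X'' Y'' : elt_ob) (s : elt_pro X Y)
    (s' : elt_pro X' Y') (s'' : elt_pro X'' Y'')
    (β : elt_cell s' s'') (α : elt_cell s s') :
  cleft (ec β ∙ ec α) = ef (comp (c := elt_tight) (el β) (el α)).
Proof. by rewrite cleftM (ecl β) (ecl α). Qed.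

Lemma elt_ccomp_r (X Y X' Y' X'' Y'' : elt_ob) (s : elt_pro X Y)
    (s' : elt_pro X' Y') (s'' : elt_pro X'' Y'')
    (β : elt_cell s' s'') (α : elt_cell s s') :
  cright (ec β ∙ ec α) = ef (comp (c := elt_tight) (er β) (er α)).
Proof. by rewrite crightM (ecr β) (ecr α). Qed.

Definition elt_ccomp (X Y X' Y' X'' Y'' : elt_ob) (s : elt_pro X Y)
  (s' : elt_pro X' Y') (s'' : elt_pro X'' Y'')
  (β : elt_cell s' s'') (α : elt_cell s s') : elt_cell s s''.
Proof.
refine (@EltCell X Y X'' Y'' s s''
  (comp (c := elt_tight) (el β) (el α)) (comp (c := elt_tight) (er β) (er α))
  (ec β ∙ ec α) (elt_ccomp_l β α) (elt_ccomp_r β α) _).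
abstract by rewrite (push1M C (elt_subproof (ecl α)) (elt_subproof (ecl β)))
    compA (ecE β) -compA (ecE α) compA.
Defined.

Definition elt_base : dbl_base.
Proof.
refine (@DblBase elt_tight elt_pro elt_cell elt_cid elt_ccomp _ _ _
  (fun X Y X' Y' s t α => el α) (fun X Y X' Y' s t α => er α) _ _ _ _).
- move=> X Y X' Y' s t α; apply: elt_cell_eq.
  + exact (comp1f (c := elt_tight) _).
  + exact (comp1f (c := elt_tight) _).
  + exact: ccomp1f.
- move=> X Y X' Y' s t α; apply: elt_cell_eq.
  + exact (compf1 (c := elt_tight) _).
  + exact (compf1 (c := elt_tight) _).
  + exact: ccompf1.
- move=> X Y X' Y' X2 Y2 X3 Y3 s s' s2 s3 γ β α; apply: elt_cell_eq.
  + exact (compA (c := elt_tight) _ _ _).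
  + exact (compA (c := elt_tight) _ _ _).
  + exact: ccompA.
- by [].
- by [].
- by [].
- by [].
Defined.

(** [(m ⊙ n, n̄ ∘ n_!(m̄) ∘ μ⁻¹)] *)
Definition elt_pcomp (X Y Z : elt_ob) (s : elt_pro X Y) (t : elt_pro Y Z) :
    elt_pro X Z :=
  @EltPro X Z (em s ⊙ em t)
    (iso_comp (iso_comp (ebar t) (iso_fmap (trans C (em t)) (ebar s)))
       (iso_inv (mu C (ea X) (em s) (em t)))).

Definition elt_pid (X : elt_ob) : elt_pro X X :=
  @EltPro X X (pid (ex X)) (iso_inv (kappa C (ea X))).

Lemma elt_pcompE (X Y Z : elt_ob) (s : elt_pro X Y) (t : elt_pro Y Z) :
  fmor (ebar (elt_pcomp s t)) ∘ fmor (mu C (ea X) (em s) (em t)) =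
  fmor (ebar t) ∘ fmor (fmap (trans C (em t)) (ebar s)).
Proof.
have : ebar (elt_pcomp s t) ∘ mu C (ea X) (em s) (em t) =
  ebar t ∘ fmap (trans C (em t)) (ebar s).
  exact: iso_comp_invK.
by move/(congr1 (@fmor _ _ _ _ _ _)).
Qed.

Lemma transE (x y : B) (m : pro x y) (a a' : fiber P x) (u : hom a a') :
  fmor (fmap (trans C m) u) = push1 C (fmor u) (cid m) (fib_cid m u).
Proof. by []. Qed.

Lemma fmor_isoVr (x : B) (a b : fiber P x) (c : E) (f : iso a b)
    (g h : hom (fval b) c) : g ∘ fmor f = h ∘ fmor f -> g = h.
Proof. exact: (@isoVr E _ _ _ (iso_fmap (fib_inc P x) f) g h). Qed.

Section Cunder.
Context (X Y Z X' Y' Z' : elt_ob) (s : elt_pro X Y)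
  (t : elt_pro Y Z) (s' : elt_pro X' Y') (t' : elt_pro Y' Z')
  (α : elt_cell s s') (β : elt_cell t t') (e : er α = el β).

Lemma elt_cunder_e : cright (ec α) = cleft (ec β).
Proof. by rewrite (ecr α) (ecl β) e. Qed.

Lemma elt_cunder_l : cleft (cunder (ec α) (ec β) elt_cunder_e) = ef (el α).
Proof. by rewrite cunder_left; exact: ecl. Qed.

Lemma elt_cunder_r : cright (cunder (ec α) (ec β) elt_cunder_e) = ef (er β).
Proof. by rewrite cunder_right; exact: ecr. Qed.

Lemma elt_cunderE :
  fmor (ebar (elt_pcomp s' t')) ∘
    push1 C (eu (el α)) (cunder (ec α) (ec β) elt_cunder_e)
      (elt_subproof elt_cunder_l) =
  eu (er β) ∘ fmor (ebar (elt_pcomp s t)).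
Proof.
have h := elt_subproof (ecl α).
have h1 : fmap P (push1 C (eu (el α)) (ec α) h) ≡ cleft (ec β).
  by rewrite push1_over elt_cunder_e.
apply: (fmor_isoVr (f := mu C (ea X) (em s) (em t))).
rewrite -[LHS]compA -(mu_nat h1 (elt_subproof elt_cunder_l)) [LHS]compA.
rewrite (elt_pcompE s' t') -[RHS]compA (elt_pcompE s t) -[LHS]compA [RHS]compA.
rewrite -(ecE β) -[RHS]compA; congr (_ ∘ _).
rewrite !transE.
have h2 : fmap P (fmor (ebar s') ∘ push1 C (eu (el α)) (ec α) h) ≡ cleft (ec β).
  by rewrite (proof_irrelevance _ h (elt_subproof (ecl α))) (ecE α) fmapM
    (comp_arr (euE (er α)) (fhvalE (isof (ebar s)))) compf1 (ecl β) e.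
rewrite (push1_cidl C _ _ h2).
have h3 : fmap P (eu (el β) ∘ fmor (ebar s)) ≡ cleft (ec β).
  by rewrite fmapM (comp_arr (euE (el β)) (fhvalE (isof (ebar s)))) compf1
    (ecl β).
rewrite (push1_cidr C _ _ h3); apply: push1_eq => //.
by rewrite (proof_irrelevance _ h (elt_subproof (ecl α))) (ecE α) e.
Qed.

Definition elt_cunder : elt_cell (elt_pcomp s t) (elt_pcomp s' t') :=
  @EltCell X Z X' Z' (elt_pcomp s t) (elt_pcomp s' t') (el α) (er β)
  (cunder (ec α) (ec β) elt_cunder_e) elt_cunder_l elt_cunder_r elt_cunderE.
End Cunder.

Lemma elt_pidcE (X Y : elt_ob) (f : elt_hom X Y)
    (h : fmap P (eu f) ≡ cleft (pidc (ef f))) :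
  fmor (ebar (elt_pid Y)) ∘ push1 C (eu f) (pidc (ef f)) h =
  eu f ∘ fmor (ebar (elt_pid X)).
Proof.
have kK Z : fmor (ebar (elt_pid Z)) ∘ fmor (kappa C (ea Z)) = idc _.
  exact: (congr1 (@fmor _ _ _ _ _ _) (isoVK (kappa C (ea Z)))).
apply: (fmor_isoVr (f := kappa C (ea X))).
rewrite -[LHS]compA -(kappa_nat C h) [LHS]compA (kK Y) comp1f.
by rewrite -[RHS]compA (kK X) compf1.
Qed.

Definition elt_pidc (X Y : elt_ob) (f : elt_hom X Y) :
    elt_cell (elt_pid X) (elt_pid Y) :=
  @EltCell X X Y Y (elt_pid X) (elt_pid Y) f f (pidc (ef f))
    (pidc_left _) (pidc_right _) (elt_pidcE _).

Lemma globularV (x y : B) (m m' : pro x y) (α : ciso m m') :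
  globular α -> globular (isoV α : cell m' m).
Proof.
case=> gl gr; split.
  have := congr1 (@cleft _ _ _ _ _ _ _) (isoVK α : isoV α ∙ cfun α = cid m).
  by rewrite cleftM gl compf1 cleft1.
have := congr1 (@cright _ _ _ _ _ _ _) (isoVK α : isoV α ∙ cfun α = cid m).
by rewrite crightM gr compf1 cright1.
Qed.

Section Giso.
Context (X Y : elt_ob) (s t : elt_pro X Y) (α : ciso (em s) (em t)).
Context (g : globular α).
Context (αE : ebar t ∘ gpush C (ea X) g = ebar s).

Lemma elt_gisoE (h : fmap P (eu (idc (X : elt_tight))) ≡ cleft α) :
  fmor (ebar t) ∘ push1 C (eu (idc (X : elt_tight))) α h =
  eu (idc (Y : elt_tight)) ∘ fmor (ebar s).
Proof.
rewrite [RHS]comp1f -αE.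
congr (fmor (ebar t) ∘ _); exact: push1_eq.
Qed.

Lemma elt_gisoVE (h : fmap P (eu (idc (X : elt_tight))) ≡ cleft (isoV α)) :
  fmor (ebar s) ∘ push1 C (eu (idc (X : elt_tight))) (isoV α : cell _ _) h =
  eu (idc (Y : elt_tight)) ∘ fmor (ebar t).
Proof.
rewrite [RHS]comp1f -αE.
have k : fmap P (idc (fval (ea X)) ∘ idc (fval (ea X))) ≡
    cleft (cfun α ∙ isoV α).
  by rewrite compf1 (isoK α : cfun α ∙ isoV α = cid _) cleft1 fmap1
    (fvalE (ea X)).
rewrite (_ : fmor (ebar t ∘ gpush C (ea X) g) =
  fmor (ebar t) ∘ push1 C (idc _) α (idc_glob (ea X) g)) // -compA.
rewrite -(push1M C h (idc_glob (ea X) g) k).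
rewrite (_ : push1 _ _ _ _ = idc _) ?compf1 //.
have k1 : fmap P (idc (fval (ea X))) ≡ cleft (cid (em t)).
  by rewrite cleft1 fmap1 (fvalE (ea X)).
rewrite -(push1_1 C k1); apply: push1_eq; rewrite ?compf1 //.
exact: (isoK α).
Qed.

Definition elt_gfun : elt_cell s t :=
  @EltCell X Y X Y s t (idc (X : elt_tight)) (idc (Y : elt_tight)) α
    g.1 g.2 (elt_gisoE _).

Definition elt_ginv : elt_cell t s :=
  @EltCell X Y X Y t s (idc (X : elt_tight)) (idc (Y : elt_tight)) (isoV α)
    (globularV g).1 (globularV g).2 (elt_gisoVE _).

Lemma elt_gVK : elt_ccomp elt_ginv elt_gfun = elt_cid s.
Proof.
apply: elt_cell_eq.
- exact: (comp1f (c := elt_tight)).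
- exact: (comp1f (c := elt_tight)).
- exact: (isoVK α).
Qed.

Lemma elt_gK : elt_ccomp elt_gfun elt_ginv = elt_cid t.
Proof.
apply: elt_cell_eq.
- exact: (comp1f (c := elt_tight)).
- exact: (comp1f (c := elt_tight)).
- exact: (isoK α).
Qed.

Definition elt_giso : ciso (D := elt_base) s t :=
  @Iso (D1 elt_base) (Loose (s : pro (d := elt_base) X Y))
    (Loose (t : pro (d := elt_base) X Y)) elt_gfun elt_ginv elt_gVK elt_gK.

Lemma elt_giso_glob : globular elt_giso.
Proof. by []. Qed.
End Giso.

Lemma ebar_pcomp (X Y Z : elt_ob) (s : elt_pro X Y) (t : elt_pro Y Z) :
  ebar (elt_pcomp s t) ∘ mu C (ea X) (em s) (em t) =
  ebar t ∘ fmap (trans C (em t)) (ebar s).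
Proof. exact: iso_comp_invK. Qed.

Lemma ebar_pid (X : elt_ob) : ebar (elt_pid X) ∘ kappa C (ea X) = idc (ea X).
Proof. exact: isoVK. Qed.

Lemma mu_fib (x y z : B) (a a' : fiber P x) (m : pro x y) (n : pro y z)
    (u : hom a a') :
  fmap (trans C (m ⊙ n)) u ∘ mu C a m n =
  mu C a' m n ∘ fmap (trans C n) (fmap (trans C m) u).
Proof.
apply: fib_hom_eq.
have e : cright (cid m) = cleft (cid n) by rewrite cright1 cleft1.
have h2 : fmap P (fhval u) ≡ cleft (cunder (cid m) (cid n) e).
  by rewrite cunder1 cleft1; exact: fhvalE.
have h1 : fmap P (push1 C (fhval u) (cid m) (fib_cid m u)) ≡ cleft (cid n).
  exact: (fib_cid n (fmap (trans C m) u)).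
rewrite -[RHS]/(fmor (mu C a' m n) ∘ fmor (fmap (trans C n) (fmap (trans C m) u))).
have -> : fmor (fmap (trans C n) (fmap (trans C m) u)) =
    push1 C (push1 C (fhval u) (cid m) (fib_cid m u)) (cid n) h1.
  exact: push1_eq.
rewrite (mu_nat h1 h2); congr (_ ∘ _).
by apply: push1_eq => //; exact/esym/cunder1.
Qed.

Lemma kappa_fib (x : B) (a a' : fiber P x) (u : hom a a') :
  fmap (trans C (pid x)) u ∘ kappa C a = kappa C a' ∘ u.
Proof.
apply: fib_hom_eq.
have h : fmap P (fhval u) ≡ cleft (pidc (idc x)).
  by rewrite pidc_left; exact: fhvalE.
change (push1 C (fhval u) (cid (pid x)) (fib_cid (pid x) u) ∘
  fmor (kappa C a) = fmor (kappa C a') ∘ fhval u).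
rewrite (kappa_nat C h); congr (_ ∘ _).
by apply: push1_eq => //; exact/esym/pidc1.
Qed.

Section Coherence.
Context (X Y Z W : elt_ob).
Context (s : elt_pro X Y) (t : elt_pro Y Z) (r : elt_pro Z W).

Lemma elt_assocE :
  ebar (elt_pcomp s (elt_pcomp t r)) ∘
    gpush C (ea X) (assoc_glob (em s) (em t) (em r)) =
  ebar (elt_pcomp (elt_pcomp s t) r).
Proof.
apply: (isoVr (f := mu C (ea X) (em s ⊙ em t) (em r))).
apply: (isoVr (f := iso_fmap (trans C (em r)) (mu C (ea X) (em s) (em t)))).
rewrite -[X in X ∘ _ = _]compA -[LHS]compA.
rewrite [X in _ ∘ X = _](mu_assoc C (ea X) (em s) (em t) (em r)) [LHS]compA.
rewrite (ebar_pcomp s (elt_pcomp t r)) -[LHS]compA mu_fib [LHS]compA.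
rewrite (ebar_pcomp t r) (ebar_pcomp (elt_pcomp s t) r).
rewrite -[LHS]compA -[RHS]compA; congr (_ ∘ _).
rewrite -[RHS]fmapM ebar_pcomp; exact/esym/fmapM.
Qed.

Lemma elt_lunitE :
  ebar s ∘ gpush C (ea X) (lunit_glob (em s)) =
  ebar (elt_pcomp (elt_pid X) s).
Proof.
apply: (isoVr (f := mu C (ea X) (pid (ex X)) (em s))).
apply: (isoVr (f := iso_fmap (trans C (em s)) (kappa C (ea X)))).
rewrite -[X in X ∘ _ = _]compA -[LHS]compA.
rewrite [X in _ ∘ X = _](mu_lunit C (ea X) (em s)) compf1.
rewrite (ebar_pcomp (elt_pid X) s) -[RHS]compA.
rewrite -[X in _ = _ ∘ X]fmapM ebar_pid fmap1; exact/esym/compf1.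
Qed.

Lemma elt_runitE :
  ebar s ∘ gpush C (ea X) (runit_glob (em s)) =
  ebar (elt_pcomp s (elt_pid Y)).
Proof.
apply: (isoVr (f := mu C (ea X) (em s) (pid (ex Y)))).
apply: (isoVr (f := kappa C (push C (ea X) (em s)))).
rewrite -[X in X ∘ _ = _]compA -[LHS]compA.
rewrite [X in _ ∘ X = _](mu_runit C (ea X) (em s)) compf1.
rewrite (ebar_pcomp s (elt_pid Y)) -[RHS]compA kappa_fib [RHS]compA ebar_pid.
exact/esym/comp1f.
Qed.

Definition elt_assoc := @elt_giso X W (elt_pcomp (elt_pcomp s t) r)
  (elt_pcomp s (elt_pcomp t r)) (assoc (em s) (em t) (em r))
  (assoc_glob _ _ _) elt_assocE.
Definition elt_lunit := @elt_giso X Y (elt_pcomp (elt_pid X) s) s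
  (lunit (em s)) (lunit_glob _) elt_lunitE.
Definition elt_runit := @elt_giso X Y (elt_pcomp s (elt_pid Y)) s
  (runit (em s)) (runit_glob _) elt_runitE.
End Coherence.

Definition elt : dblcat.
Proof.
refine (@DblCat elt_base elt_pcomp elt_cunder _ _ _ _ elt_pid elt_pidc
  _ _ _ _ elt_assoc elt_lunit elt_runit _ _ _ _ _ _ _ _).
- by [].
- by [].
- move=> X Y Z s t e; apply: elt_cell_eq => //=; exact: cunder1.
- move=> X Y Z X' Y' Z' X2 Y2 Z2 s t s' t' s2 t2 α β α' β' e e' e2.
  by apply: elt_cell_eq => //=; exact: cunderM.
- by [].
- by [].
- by move=> X; apply: elt_cell_eq => //=; exact: pidc1.
- by move=> X Y Z g f; apply: elt_cell_eq => //=; exact: pidcM.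
- by [].
- by [].
- by [].
- move=> X Y Z W X' Y' Z' W' s t r s' t' r' α β γ e1 e2 e3 e4.
  apply: elt_cell_eq.
  + exact: (etrans (comp1f (c := elt_tight) _)
      (esym (compf1 (c := elt_tight) _))).
  + exact: (etrans (comp1f (c := elt_tight) _)
      (esym (compf1 (c := elt_tight) _))).
  + exact: assoc_nat.
- move=> X Y X' Y' s s' α e; apply: elt_cell_eq.
  + exact: (etrans (comp1f (c := elt_tight) _)
      (esym (compf1 (c := elt_tight) _))).
  + exact: (etrans (comp1f (c := elt_tight) _)
      (esym (compf1 (c := elt_tight) _))).
  + rewrite /=; have E0 : cright (pidc (cleft (ec α))) = cleft (ec α).
      by rewrite pidc_right.
    rewrite -(lunit_nat E0); congr (_ ∙ _); apply: cunder_eq => //.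
    by rewrite (ecl α).
- move=> X Y X' Y' s s' α e; apply: elt_cell_eq.
  + exact: (etrans (comp1f (c := elt_tight) _)
      (esym (compf1 (c := elt_tight) _))).
  + exact: (etrans (comp1f (c := elt_tight) _)
      (esym (compf1 (c := elt_tight) _))).
  + rewrite /=; have E0 : cright (ec α) = cleft (pidc (cright (ec α))).
      by rewrite pidc_left.
    rewrite -(runit_nat E0); congr (_ ∙ _); apply: cunder_eq => //.
    by rewrite (ecr α).
- move=> X Y Z W V s t r q e1 e2; apply: elt_cell_eq.
  + by apply: elt_hom_eq; rewrite /= ?compf1.
  + by apply: elt_hom_eq; rewrite /= ?compf1.
  + exact: pentagon.
- move=> X Y Z s t e1 e2; apply: elt_cell_eq.
  + by apply: elt_hom_eq; rewrite /= ?compf1.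
  + by apply: elt_hom_eq; rewrite /= ?compf1.
  + exact: triangle.
Defined.

Definition elt_proj0 : functor elt B :=
  @Functor elt_tight B ex (fun X Y f => ef f) (fun=> erefl)
    (fun _ _ _ _ _ => erefl).

Definition elt_proj : dfunctor elt B.
Proof.
refine (@DFunctor elt B elt_proj0 (fun X Y (s : elt_pro X Y) => em s)
  (fun X Y X' Y' (s : elt_pro X Y) (s' : elt_pro X' Y') (α : elt_cell s s') =>
     ec α)
  _ _ _ _
  (fun X Y Z (s : elt_pro X Y) (t : elt_pro Y Z) =>
     iso_id (Loose (em s ⊙ em t) : D1 B))
  (fun X => iso_id (Loose (pid (ex X)) : D1 B)) _ _ _ _ _ _ _).
- by [].
- by [].
- by move=> X Y X' Y' s s' α; exact: ecl.
- by move=> X Y X' Y' s s' α; exact: ecr.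
- by move=> X Y Z s t; split; rewrite /= ?cleft1 ?cright1.
- by move=> X; split; rewrite /= ?cleft1 ?cright1.
- move=> X Y Z X' Y' Z' s t s' t' α β e e' /=.
  by rewrite ccomp1f ccompf1; exact: cunder_eq.
- by move=> X Y f /=; rewrite ccomp1f ccompf1.
- by move=> X Y Z W s t r e1 e2 /=; rewrite !cunder1 !ccompf1 ccomp1f.
- by move=> X Y t e /=; rewrite !cunder1 !ccompf1.
- by move=> X Y t e /=; rewrite !cunder1 !ccompf1.
Defined.

End Elements.

Definition own_ob (E B : dblcat) (P : dfunctor E B) (C : cleavage P) (a : E) :
  elt C := EltOb (own_fib P a).

Definition own_hom (E B : dblcat) (P : dfunctor E B) (C : cleavage P) (a b : E)
    (u : hom a b) : hom (own_ob C a) (own_ob C b) :=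
  @EltHom _ _ P (own_ob C a) (own_ob C b) (fmap P u) u erefl.

Definition own_pro (E B : dblcat) (P : dfunctor E B) (C : cleavage P) (a b : E)
    (t : pro a b) (i : iso (push C (own_fib P a) (Fpro P t)) (own_fib P b)) :
  pro (own_ob C a) (own_ob C b) :=
  @EltPro _ _ P C (own_ob C a) (own_ob C b) (Fpro P t) i.

(* Main.v *)
(** The functor [⟨src, P_1⟩] sends each counit [ε_t] to an identity and is fully
    faithful, so [ε_t], hence [tgt ε_t], is invertible; with this, the axioms on
    the cleavage are exactly what is needed for [R] to be a double functor. A cell
    of [elt C] is determined by its left arrow and its underlying cell of [B],
    because the isomorphism [m̄] of its top proarrow can be cancelled in the
    equation it satisfies. Thus [elt_srcP : D1 (elt C) -> E_0 ×_{B_0} B_1] is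
    fully faithful, and since it composes with [R_1] to the weak equivalence
    [⟨src, P_1⟩], [R_1] is a weak equivalence too. *)

From Stdlib Require Import IndefiniteDescription.
Set Warnings "-notation-overridden".
From mathcomp Require Import all_boot.
Require Import Defs.

Set Implicit Arguments.
Unset Strict Implicit.
Unset Printing Implicit Defensive.

(** * Lifting and cancelling isomorphisms and weak equivalences *)

Lemma iso_of_arr_idc (C : category) (x y z : C) (f : hom x y) :
  f ≡ idc z -> exists i : iso x y, isof i = f.
Proof.
(* Induction on the equality of arrows replaces [f] by [idc z], endpoints included. *)
move=> h; apply: (arr_ind (Q := fun x y f => exists i : iso x y, isof i = f)).
  exact: esym h.
by exists (iso_id z).
Qed.

Lemma fully_faithful_iso (C D : category) (F : functor C D) (x y : C)
    (i : iso (F x) (F y)) :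
  fully_faithful F -> exists j : iso x y, fmap F (isof j) = isof i.
Proof.
move=> ff; have [f _ fK] := ff x y; have [g _ gK] := ff y x.
have VK : g (isoV i) ∘ f (isof i) = idc x.
  by apply: (bij_inj (ff x x)); rewrite fmapM fK gK fmap1 isoVK.
have K : f (isof i) ∘ g (isoV i) = idc y.
  by apply: (bij_inj (ff y y)); rewrite fmapM fK gK fmap1 isoK.
by exists (Iso VK K); rewrite /= fK.
Qed.

(** Full faithfulness of [G] reflects bijectivity on arrows and lifts each isomorphism
    [G (F x) ≅ G y] to [F x ≅ y]. *)
Lemma weak_equivalence_cancel (C D E : category)
    (F : functor C D) (G : functor D E) :
  fully_faithful G -> weak_equivalence (functor_comp G F) -> weak_equivalence F.
Proof.
move=> Gff [GFff GFess]; split=> [x y|y].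
  have [g gK Kg] := GFff x y.
  exists (fun f => g (fmap G f)) => f; first exact: gK.
  by apply: (bij_inj (Gff _ _)); exact: Kg.
have [x [i]] := GFess (G y).
have [j _] := @fully_faithful_iso _ _ G (F x) y i Gff.
by exists x; exact: inhabits j.
Qed.

(** The inverse of an arrow lying over an identity lies over an identity as well, so it is an arrow
    of the fiber. *)
Lemma fiber_iso (C D : category) (F : functor C D) (x : D) (a b : fiber F x)
    (f : hom a b) (i : iso (fval a) (fval b)) :
  isof i = fmor f -> exists j : iso a b, isof j = f.
Proof.
move=> e.
have h : fmap F (isoV i) ≡ idc x.
  have fE : fmap F (isof i) ≡ idc (F (fval b)).
    by rewrite e; exact: etrans (fhvalE f) (idc_arr (esym (fvalE b))).
  have := comp_arr (erefl (Arr (fmap F (isoV i)))) fE.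
  rewrite compf1 -fmapM isoVK fmap1 => <-; exact: idc_arr (fvalE a).
have VK : comp (c := fiber F x) (FibHom h) f = idc a.
  by apply: fib_hom_eq; rewrite /= -[fhval f]e isoVK.
have K : comp (c := fiber F x) f (FibHom h) = idc b.
  by apply: fib_hom_eq; rewrite /= -[fhval f]e isoK.
by exists (Iso VK K).
Qed.

(** * The comparison double functor [R] *)

Section Equivalence.
Context (E B : dblcat) (P : dfunctor E B) (C : cleavage P).

Lemma tcounit_iso (HP : loosely_discrete_opfibration P) (a b : E)
    (t : pro a b) :
  exists i : iso (push C (own_fib P a) (Fpro P t)) (own_fib P b),
    isof i = tcounit C t.
Proof.
have [i iE] := iso_of_arr_idc (lari_tri1 C (Loose t)).
have [j jE] := fully_faithful_iso i HP.1.
have {iE}jE : isof j = counit C (Loose t).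
  by apply: (bij_inj (HP.1 _ _)); rewrite jE.
apply: (@fiber_iso _ _ P _ _ _ (tcounit C t) (iso_fmap (tgt E) j)).
by rewrite /= jE.
Qed.

Section Comparison.
(** A proarrow of [elt C] carries its isomorphism as data, while [tcounit_iso] only asserts
    existence; a choice of inverses for all [tcounit C t] is therefore a parameter. *)
Context (i : forall (a b : E) (t : pro a b),
  iso (push C (own_fib P a) (Fpro P t)) (own_fib P b)).
Context (iE : forall (a b : E) (t : pro a b), isof (i t) = tcounit C t).

Definition cmp0 : functor E (elt C).
Proof.
refine (@Functor E (elt C) (own_ob C) (@own_hom _ _ P C) _ _).
- by move=> a; apply: elt_hom_eq => //=; rewrite fmap1.
- by move=> a b c v u; apply: elt_hom_eq => //=; rewrite fmapM.
Defined.

Definition cmp_pro (a b : E) (t : pro a b) : pro (own_ob C a) (own_ob C b) :=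
  own_pro (i t).

(** This is naturality of the counit at [α], read off on right arrows. *)
Lemma cmp_cellE (a b a' b' : E) (s : pro a b) (s' : pro a' b') (α : cell s s')
    (h : fmap P (cleft α) ≡ cleft (Fcell P α)) :
  fmor (isof (i s')) ∘ push1 (a := own_fib P a) (a' := own_fib P a')
    C (cleft α) (Fcell P α) h = cright α ∘ fmor (isof (i s)).
Proof.
rewrite !iE.
have := congr1 (@cright _ _ _ _ _ _ _)
  (counit_nat C (t := Loose s) (t' := Loose s') α).
rewrite !crightM => <-; congr (_ ∘ cright (fmap C _)); exact: pb_hom_eq.
Qed.

Definition cmp_cell (a b a' b' : E) (s : pro a b) (s' : pro a' b')
    (α : cell s s') : cell (cmp_pro s) (cmp_pro s') :=
  @EltCell _ _ P C _ _ _ _ (cmp_pro s) (cmp_pro s')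
    (own_hom C (cleft α)) (own_hom C (cright α)) (Fcell P α)
    (Fcell_left _ α) (Fcell_right _ α) (cmp_cellE _).

(** Precomposing with [mu] cancels the inverse of [mu] in the loose composite and leaves the
    associativity axiom of the cleavage. *)
Lemma cmp_compE (a b c : E) (s : pro a b) (t : pro b c) :
  ebar (cmp_pro (s ⊙ t)) ∘ gpush C (own_fib P a) (Fcomp_glob P s t) =
  ebar (elt_pcomp (cmp_pro s) (cmp_pro t)).
Proof.
apply: (isoVr (f := mu C (own_fib P a) (Fpro P s) (Fpro P t))).
rewrite (ebar_pcomp (cmp_pro s) (cmp_pro t)) /= !iE; exact: counit_assoc.
Qed.

(** Likewise, precomposing with [kappa] leaves the unitality axiom. *)
Lemma cmp_idE (a : E) :
  ebar (cmp_pro (pid a)) ∘ gpush C (own_fib P a) (Fid_glob P a) =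
  ebar (elt_pid C (own_ob C a)).
Proof.
apply: (isoVr (f := kappa C (own_fib P a))).
rewrite (ebar_pid C (own_ob C a)) /= iE; exact: counit_unit.
Qed.

Definition cmp_comp (a b c : E) (s : pro a b) (t : pro b c) :=
  elt_giso (s := elt_pcomp (cmp_pro s) (cmp_pro t)) (t := cmp_pro (s ⊙ t))
    (g := Fcomp_glob P s t) (cmp_compE s t).

Definition cmp_id (a : E) :=
  elt_giso (s := elt_pid C (own_ob C a)) (t := cmp_pro (pid a))
    (g := Fid_glob P a) (cmp_idE a).

Definition cmp : dfunctor E (elt C).
Proof.
refine (@DFunctor E (elt C) cmp0 cmp_pro cmp_cell _ _ _ _
  cmp_comp cmp_id _ _ _ _ _ _ _).
(* Each equation of cells splits into two equations of side arrows, where globular cells contribute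
   identities, and one in [B], which is the corresponding law of [P]. *)
- move=> a b s; apply: elt_cell_eq.
  + by rewrite /= cleft1; exact: (fmap1 cmp0).
  + by rewrite /= cright1; exact: (fmap1 cmp0).
  + exact: Fcell1.
- move=> a b a' b' a2 b2 s s' s2 β α; apply: elt_cell_eq.
  + by rewrite /= cleftM; exact: (fmapM cmp0).
  + by rewrite /= crightM; exact: (fmapM cmp0).
  + exact: FcellM.
- by [].
- by [].
- by [].
- by [].
- move=> a b c a' b' c' s t s' t' α β e e'; apply: elt_cell_eq.
  + by apply: elt_hom_eq; rewrite /= cunder_left comp1f compf1.
  + by apply: elt_hom_eq; rewrite /= cunder_right comp1f compf1.
  + exact: Fcomp_nat.
- move=> a b u; apply: elt_cell_eq.
  + by apply: elt_hom_eq; rewrite /= pidc_left comp1f compf1.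
  + by apply: elt_hom_eq; rewrite /= pidc_right comp1f compf1.
  + exact: Fid_nat.
- move=> a b c d s t r e1 e2; have [l r'] := assoc_glob s t r.
  apply: elt_cell_eq.
  + by apply: elt_hom_eq; rewrite /= l ?fmap1 !compf1.
  + by apply: elt_hom_eq; rewrite /= r' ?fmap1 !compf1.
  + exact: Fassoc.
- move=> a b t e; have [l r] := lunit_glob t.
  apply: elt_cell_eq.
  + by apply: elt_hom_eq; rewrite /= l ?fmap1 !compf1.
  + by apply: elt_hom_eq; rewrite /= r ?fmap1 !compf1.
  + exact: Flunit.
- move=> a b t e; have [l r] := runit_glob t.
  apply: elt_cell_eq.
  + by apply: elt_hom_eq; rewrite /= l ?fmap1 !compf1.
  + by apply: elt_hom_eq; rewrite /= r ?fmap1 !compf1.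
  + exact: Frunit.
Defined.

Lemma cmp_proj : dfunctor_eq (dfunctor_comp (elt_proj C) cmp) P.
Proof.
split=> // [a b c s t|a].
  by congr Arr; exact: ccompf1.
by congr Arr; exact: ccompf1.
Qed.

(** * The weak equivalences [R_0] and [R_1] *)

Lemma cmp0_weq : weak_equivalence (F0 cmp).
Proof.
split=> [a b|[x [a ax]]].
  exists (fun f : hom (own_ob C a) (own_ob C b) => eu f) => // f.
  by apply: elt_hom_eq => //; apply: arr_inj; exact: (euE f).
(* Eliminating [ax : P a = x] turns the given object into [own_ob C a] itself. *)
by exists a; case: x / ax; exact: inhabits (iso_id _).
Qed.

Definition elt_srcP : functor (D1 (elt C)) (pullback P (src B)).
Proof.
refine (@Functor (D1 (elt C)) (pullback P (src B))
  (fun s => lift_ob (ea (lsrc s)) (em (lpro s)))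
  (fun s t α => lift_hom (elt_subproof (ecl α))) _ _).
- by move=> s; exact: pb_hom_eq.
- by move=> s t r β α; exact: pb_hom_eq.
Defined.

Section EltLift.
Context (X Y X' Y' : elt C) (s : pro X Y) (t : pro X' Y').
Context (f : pb_hom (lift_ob (ea X) (em s)) (lift_ob (ea X') (em t))).

Let θ : cell (em s) (em t) := pbh2 f.

Definition elt_lift_left : hom X X' :=
  EltHom (pbhE f : fmap P (pbh1 f) ≡ cleft θ).

(** Solving [ecE] for the right arrow leaves only this value. *)
Definition elt_lift_tgt : hom (fval (ea Y)) (fval (ea Y')) :=
  fmor (isof (ebar t)) ∘ push1 C (pbh1 f) θ (pbhE f) ∘ fmor (isoV (ebar s)).

Lemma elt_lift_tgt_over : fmap P elt_lift_tgt ≡ cright θ.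
Proof.
rewrite !fmapM (comp_arr (comp_arr (fhvalE _) (push1_over C (pbhE f)))
  (fhvalE (isoV (ebar s)))).
by rewrite comp1f compf1.
Qed.

Lemma elt_liftE (h : fmap P (pbh1 f) ≡ cleft θ) :
  fmor (ebar t) ∘ push1 C (pbh1 f) θ h = elt_lift_tgt ∘ fmor (ebar s).
Proof.
have VK : fmor (isoV (ebar s)) ∘ fmor (ebar s) = idc _.
  exact: (congr1 (@fmor _ _ _ _ _ _) (isoVK (ebar s))).
rewrite -[RHS]compA VK compf1.
by congr (_ ∘ _); exact: push1_eq.
Qed.

Definition elt_lift : cell s t :=
  @EltCell _ _ P C X Y X' Y' s t elt_lift_left (EltHom elt_lift_tgt_over) θ
    erefl erefl (elt_liftE _).
End EltLift.

Lemma elt_cell_inj (X Y X' Y' : elt C) (s : pro X Y) (t : pro X' Y')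
    (α β : cell s t) : eu (el α) = eu (el β) -> ec α = ec β -> α = β.
Proof.
move=> e1 e2; apply: elt_cell_eq => //; apply: elt_hom_eq => //.
- by rewrite -!ecl e2.
- by rewrite -!ecr e2.
- apply: (fmor_isoVr (f := ebar s)); rewrite -!ecE.
  by congr (_ ∘ _); exact: push1_eq.
Qed.

Lemma elt_srcP_ff : fully_faithful elt_srcP.
Proof.
move=> s t; exists (@elt_lift _ _ _ _ (lpro s) (lpro t)) => [α|f].
  exact: elt_cell_inj.
exact: pb_hom_eq.
Qed.

Lemma cmp1_weq :
  loosely_discrete_opfibration P -> weak_equivalence (F1 cmp).
Proof.
move=> [ff ess]; apply: weak_equivalence_cancel elt_srcP_ff _; split.
  (* The composite of [elt_srcP] with [R_1] agrees with [srcP P] on objects by computation, and on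
     cells up to the proofs [pbhE]. *)
  by move=> s t; apply: (eq_bij (ff s t)) => α; exact: pb_hom_eq.
exact: ess.
Qed.

End Comparison.
End Equivalence.

Theorem proposition6p14 (E B : dblcat) (P : dfunctor E B)
    (HP : loosely_discrete_opfibration P) (C : cleavage P) :
  exists R : dfunctor E (elt C),
    (forall a : E, R a = own_ob C a) /\
    (forall (a b : E) (u : hom a b), fmap R u ≡ own_hom C u) /\
    (forall (a b : E) (t : pro a b),
      exists i : iso (push C (own_fib P a) (Fpro P t)) (own_fib P b),
        isof i = tcounit C t /\ Loose (Fpro R t) = Loose (own_pro i)) /\
    (forall (a b a' b' : E) (s : pro a b) (s' : pro a' b') (α : cell s s'),
      ec (Fcell R α) ≣ Fcell P α) /\
    (forall (a b c : E) (s : pro a b) (t : pro b c),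
      ec (cfun (Fcomp R s t)) ≣ cfun (Fcomp P s t)) /\
    (forall a : E, ec (cfun (Fid R a)) ≣ cfun (Fid P a)) /\
    dfunctor_eq (dfunctor_comp (elt_proj C) R) P /\
    weak_equivalence (F0 R) /\
    weak_equivalence (F1 R).
Proof.
(* Choice turns the invertibility of each counit into a family of isomorphisms from which [R] is
   built. *)
pose i a b (t : pro a b) :=
  constructive_indefinite_description _ (tcounit_iso C HP t).
pose iE a b (t : pro a b) := proj2_sig (i a b t).
exists (cmp iE); split=> //; split=> //; split.
  by move=> a b t; exists (proj1_sig (i a b t)).
do 3![split=> //]; split; first exact: cmp_proj.
split; [exact: cmp0_weq | exact: cmp1_weq].
Qed.
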